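(* If $G$ is a bipartite graph, then $\chi^{c}_i(G)=2\Delta(G)$.
   Context: An incidence of a graph $G$ is a pair $(v,e)$ where $v$ is a vertex and $e$ an edge incident with $v$. For a vertex $w$, let $I(w)$ be the set of all incidences $(u,e)$ such that $e$ is incident with $w$. Two incidences conflict if both lie in $I(w)$ for some vertex $w$. A conflict-free incidence $k$-coloring assigns colors from a $k$-element set to the incidences so that conflicting incidences get distinct colors; $\chi^{c}_i(G)$ is the least such $k$. $\Delta(G)$ denotes the maximum degree. Graphs are finite. *)

(* Defs.v *)
From HB Require Import structures.
From mathcomp Require Import all_boot.

Set Implicit Arguments.
Unset Strict Implicit.
Unset Printing Implicit Defensive.

Record sgraph := SGraph {
  vertex :> finType;
  adj : rel vertex;
  adj_sym : symmetric adj;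
  adj_irrefl : irreflexive adj
}.

Section Graph.
Variable G : sgraph.

Definition edges : {set {set G}} :=
  [set e : {set G} | [exists x : G, exists y : G, adj x y && (e == [set x; y])]].

Definition deg (v : G) : nat := #|[set x : G | adj v x]|.

Definition max_degree : nat := \max_(v : G) deg v.

Definition bipartite : Prop :=
  exists A : {set G}, forall x y : G, adj x y -> (x \in A) != (y \in A).

(* Incidences form their own finite type, so that an edgeless graph has a
   colouring with no colours at all. *)
Definition incidence : finType :=
  {p : G * {set G} | (p.2 \in edges) && (p.1 \in p.2)}.

Definition inc_edge (i : incidence) : {set G} := (val i).2.

Definition incidences_at (w : G) : {set incidence} :=
  [set i : incidence | w \in inc_edge i].

Definition conflict (i j : incidence) : bool :=
  (i != j) &&
  [exists w : G, (i \in incidences_at w) && (j \in incidences_at w)].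

Definition conflict_free (k : nat) (c : {ffun incidence -> 'I_k}) : bool :=
  [forall i : incidence, forall j : incidence, conflict i j ==> (c i != c j)].

Definition cf_colorable (k : nat) : bool :=
  [exists c : {ffun incidence -> 'I_k}, conflict_free c].

Lemma cf_colorable_ex : exists k, cf_colorable k.
Proof.
exists #|incidence|; apply/existsP; exists [ffun i => enum_rank i].
apply/forallP=> i; apply/forallP=> j; apply/implyP=> /andP[neq_ij _].
by rewrite !ffunE (inj_eq enum_rank_inj).
Qed.

Definition cf_incidence_chromatic : nat := ex_minn cf_colorable_ex.

End Graph.

(* Main.v *)
(** The incidences at a vertex [w] are pairwise in conflict and there are
    [2 * deg w] of them, whence the lower bound.  For the upper bound, König's
    edge-colouring theorem properly colours the edges of a bipartite graph with
    [Δ] colours; every edge colour is then split into two incidence colours, one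
    for each side of the bipartition.  König's theorem is proved by adding the
    edges one at a time and recolouring along a Kempe chain. *)

Require Import Defs.
From mathcomp Require Import all_boot.
From mathcomp Require Import zify.


Set Implicit Arguments.
Unset Strict Implicit.
Unset Printing Implicit Defensive.

Lemma connect_last (T : finType) (r : rel T) (x y : T) :
  connect r x y -> y = x \/ exists2 z, connect r x z & r z y.
Proof.
case/connectP=> p; case/lastP: p => [_ ->|p z]; first by left.
rewrite rcons_path last_rcons => /andP[xp rz] ->; right.
by exists (last x p) => //; apply/connectP; exists p.
Qed.

(** * Proper edge colourings of bipartite multigraphs *)

Section Konig.
(* A bipartite multigraph: the edge [e] joins [s e : S] to [t e : T]. *)
Variables (E : finType) (S T : eqType) (s : E -> S) (t : E -> T).

Definition proper_on (F : {set E}) (c : E -> nat) : Prop :=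
  {in F &, forall e f, (s e == s f) || (t e == t f) -> c e = c f -> e = f}.

(** Pigeonhole: were every colour below [D] used, [iota 0 D] would embed into the list of colours of
    [F]. *)
Lemma missing_colour (F : {set E}) (c : E -> nat) (D : nat) :
  #|F| < D -> exists2 a, a < D & forall f, f \in F -> c f != a.
Proof.
move=> FD; have /existsP[a /forallP Ha] :
    [exists a : 'I_D, [forall f : E, (f \in F) ==> (c f != a)]].
  apply: contraLR FD; rewrite negb_exists -leqNgt => /forallP noa.
  have sub : {subset iota 0 D <= [seq c f | f <- enum F]}.
    move=> a; rewrite mem_iota /= add0n => aD.
    have := noa (Ordinal aD); rewrite negb_forall => /existsP[f].
    rewrite negb_imply negbK => /andP[fF /eqP /= cf].
    by apply/mapP; exists f; rewrite ?mem_enum.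
  have := uniq_leq_size (iota_uniq 0 D) sub.
  by rewrite size_iota size_map -cardE.
exists (val a) => [|f fF]; first exact: ltn_ord.
by apply: (implyP (Ha f)).
Qed.

(** * Kempe chains and the exchange of two colours *)

Section Kempe.
Variables (F : {set E}) (c : E -> nat) (a b : nat) (f0 : E).
Hypotheses (cP : proper_on F c) (ab : a != b).

(** Steps are directed: an [a]-edge is left through its [S]-end and a [b]-edge through its [T]-end.
    This traces the [a]/[b] path that starts with [f0] at its [T]-end. *)
Definition kempe_step (f g : E) : bool :=
  [&& f \in F, g \in F &
      [&& c f == a, c g == b & s f == s g]
   || [&& c f == b, c g == a & t f == t g]].

Definition kempe_chain (f : E) : bool := connect kempe_step f0 f.

Definition kempe_swap (f : E) : nat :=
  if kempe_chain f then (if c f == a then b else a) else c f.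

Hypotheses (f0F : f0 \in F) (cf0 : c f0 = a).
Hypothesis f0_end : forall f, f \in F -> t f = t f0 -> c f != b.

Lemma kempe_chain_colour (f : E) : kempe_chain f -> f \in F /\ (c f = a \/ c f = b).
Proof.
case/connect_last=> [->|[g _]]; first by split=> //; left.
by case/and3P=> _ fF /orP[]/and3P[_ /eqP-> _]; split=> //; [right | left].
Qed.

Lemma kempe_chain_pred (f : E) :
  kempe_chain f -> f != f0 -> exists2 g, kempe_chain g & kempe_step g f.
Proof. by case/connect_last=> [->|//]; rewrite eqxx. Qed.

(* The chain is generated by forward steps only; it is nevertheless closed under
   adjacency, as an edge with the other colour that is met behind an edge of the
   chain has to be its predecessor, since [c] is proper. *)
Lemma kempe_chain_closed (f g : E) :
  kempe_chain f -> g \in F -> c g = a \/ c g = b ->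
  (s f == s g) || (t f == t g) -> kempe_chain g.
Proof.
move=> Kf gF cg fg; have [fF cf] := kempe_chain_colour Kf.
have same : c f = c g -> kempe_chain g by move=> cfg; rewrite -(cP fF gF fg cfg).
have next : kempe_step f g -> kempe_chain g.
  by move=> st; apply: (connect_trans Kf); apply: connect1.
have prev (h : E) : kempe_chain h -> c h = c g -> (s h == s g) || (t h == t g) ->
    kempe_chain g.
  move=> Kh chg hg; have [hF _] := kempe_chain_colour Kh.
  by rewrite -(cP hF gF hg chg).
case: cf cg => cf [] cg; try by apply: same; rewrite cf cg.
- case/orP: fg => fg; first by apply: next; rewrite /kempe_step fF gF cf cg fg !eqxx.
  (* Only [f0] may lack a predecessor, and [f0_end] forbids a [b]-edge behind it. *)
  have [ff0|ff0] := eqVneq f f0.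
    by have := f0_end gF; rewrite cg eqxx -(eqP fg) ff0 => /(_ erefl).
  have [h Kh /and3P[_ _]] := kempe_chain_pred Kf ff0.
  rewrite cf eqxx (negbTE ab) /= andbF /= => /andP[/eqP ch /eqP hf].
  by apply: (prev h) => //; rewrite ?ch ?hf ?fg ?orbT.
- case/orP: fg => fg; last first.
    by apply: next; rewrite /kempe_step fF gF cf cg fg !eqxx orbT.
  have ff0 : f != f0 by apply: contraNneq ab => ff0; rewrite -cf0 -ff0 cf.
  have [h Kh /and3P[_ _]] := kempe_chain_pred Kf ff0.
  rewrite cf eqxx (eq_sym b) (negbTE ab) /= andbF orbF => /andP[/eqP ch /eqP hf].
  by apply: (prev h) => //; rewrite ?ch ?hf ?fg.
Qed.

(** Exchanging [a] and [b] is injective on the chain. An edge off the chain that clashed with an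
    adjacent chain edge would be coloured [a] or [b], so closure would put it on the chain. *)
Lemma kempe_swap_proper : proper_on F kempe_swap.
Proof.
have mixed (e f : E) : e \in F -> f \in F -> (s e == s f) || (t e == t f) ->
    kempe_chain e -> ~~ kempe_chain f -> kempe_swap e != kempe_swap f.
  move=> eF fF ef Ke Kf; rewrite /kempe_swap Ke (negbTE Kf).
  apply: contra Kf => /eqP cf; apply: (kempe_chain_closed Ke) => //.
  by rewrite -cf; case: ifP; [right | left].
move=> e f eF fF ef swap_ef.
case Ke: (kempe_chain e); case Kf: (kempe_chain f).
- apply: cP => //; move: swap_ef; rewrite /kempe_swap Ke Kf.
  have [_ [->|->]] := kempe_chain_colour Ke;
  have [_ [->|->]] := kempe_chain_colour Kf;
  rewrite ?eqxx // (eq_sym b) (negbTE ab) => ba //;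
  by have := ab; rewrite ba eqxx.
- by have := mixed e f eF fF ef Ke (negbT Kf); rewrite swap_ef eqxx.
- have := mixed f e fF eF; rewrite (eq_sym (s f)) (eq_sym (t f)) => /(_ ef Kf (negbT Ke)).
  by rewrite swap_ef eqxx.
- by apply: cP => //; move: swap_ef; rewrite /kempe_swap Ke Kf.
Qed.

Lemma kempe_swap_lt (D : nat) :
  a < D -> b < D -> {in F, forall f, c f < D} -> {in F, forall f, kempe_swap f < D}.
Proof.
by move=> aD bD cD f fF; rewrite /kempe_swap; case: ifP => _; [case: ifP | apply: cD].
Qed.

(** By properness [f0] was the only [a]-edge at its [T]-end, and it turns into [b]; no [b]-edge is
    there to turn into [a]. *)
Lemma kempe_swap_target (f : E) : f \in F -> t f = t f0 -> kempe_swap f != a.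
Proof.
move=> fF ft; rewrite /kempe_swap; case: ifP => Kf.
  case: ifP => [_|cf]; first by rewrite eq_sym.
  have [_ [ca|cb]] := kempe_chain_colour Kf; first by rewrite ca eqxx in cf.
  by have := f0_end fF ft; rewrite cb eqxx.
apply/negP=> /eqP cf.
by move: Kf; rewrite (cP fF f0F _ _) ?ft ?eqxx ?orbT ?cf ?cf0 // /kempe_chain connect0.
Qed.

(* Bipartiteness enters here: the chain enters the [S]-side along [a]-edges only,
   so it cannot reach a vertex [u] at which [a] is missing. *)
Lemma kempe_swap_source (u : S) :
  (forall f, f \in F -> s f = u -> c f != a) ->
  forall f, f \in F -> s f = u -> kempe_swap f != a.
Proof.
move=> ua f fF fu; rewrite /kempe_swap; case: ifP => Kf; last exact: ua.
case: ifP => [_|cf]; first by rewrite eq_sym.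
have ff0 : f != f0 by apply: contraFneq cf => ->; rewrite cf0.
have [h Kh /and3P[hF _]] := kempe_chain_pred Kf ff0.
rewrite cf andbF /= orbF => /and3P[ch _ /eqP hf].
by have := ua h hF; rewrite hf fu ch => /(_ erefl).
Qed.

End Kempe.

(** * Kőnig's theorem, by induction on the number of edges *)

Theorem konig_edge_colouring (D : nat) (F : {set E}) :
  (forall x, #|[set f in F | s f == x]| <= D) ->
  (forall y, #|[set f in F | t f == y]| <= D) ->
  exists2 c : E -> nat, proper_on F c & {in F, forall f, c f < D}.
Proof.
have [n] := ubnP #|F|; elim: n F => // n IHn F Fn sD tD.
have [->|/set0Pn[e eF]] := eqVneq F set0.
  by exists (fun=> 0) => [e|e]; rewrite ?inE.
set F' := F :\ e.
have sub (P : pred E) : #|[set f in F' | P f]| <= #|[set f in F | P f]|.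
  by apply/subset_leq_card/subsetP=> f; rewrite !inE -andbA => /and3P[_ -> ->].
have lt (P : pred E) : P e -> #|[set f in F' | P f]| < #|[set f in F | P f]|.
  move=> Pe; apply/proper_card/properP; split.
    by apply/subsetP=> f; rewrite !inE -andbA => /and3P[_ -> ->].
  by exists e; rewrite !inE ?eqxx ?eF.
have [|x|y|c cP cD] := IHn F'.
- by move: Fn; rewrite (cardsD1 e) eF.
- exact: leq_trans (sub _) (sD x).
- exact: leq_trans (sub _) (tD y).
(* Without [e], each end of [e] meets fewer than [D] edges, so [a] is free at one end and [b] at the
   other. *)
have [a aD a_miss] : exists2 a, a < D & forall f, f \in F' -> s f = s e -> c f != a.
  have [|a aD miss] := @missing_colour [set f in F' | s f == s e] c D.
    by apply: leq_trans (sD (s e)); apply: lt.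
  by exists a => // f fF fe; apply: miss; rewrite inE fF fe eqxx.
have [b bD b_miss] : exists2 b, b < D & forall f, f \in F' -> t f = t e -> c f != b.
  have [|b bD miss] := @missing_colour [set f in F' | t f == t e] c D.
    by apply: leq_trans (tD (t e)); apply: lt.
  by exists b => // f fF fe; apply: miss; rewrite inE fF fe eqxx.
(* Once [a] is free at both ends, [e] can receive it. *)
suff [c' [c'P c'D c's c't]] : exists c' : E -> nat,
    [/\ proper_on F' c', {in F', forall f, c' f < D},
        forall f, f \in F' -> s f = s e -> c' f != a
      & forall f, f \in F' -> t f = t e -> c' f != a].
  have F'P (f : E) : f \in F -> f != e -> f \in F' by rewrite !inE => -> ->.
  have new (f : E) : f \in F -> f != e -> (s f == s e) || (t f == t e) -> c' f != a.
    by move=> fF fe /orP[]/eqP; [apply: c's | apply: c't]; apply: F'P.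
  exists (fun f => if f == e then a else c' f) => [f g fF gF|f fF]; last first.
    by case: eqVneq => // fe; apply/c'D/F'P.
  case: (eqVneq f e) => [->|fe]; case: (eqVneq g e) => [->|ge] // fg cfg.
  - by have := new g gF ge; rewrite (eq_sym (s g)) (eq_sym (t g)) fg -cfg eqxx => /(_ isT).
  - by have := new f fF fe fg; rewrite cfg eqxx.
  - by apply: c'P; rewrite ?F'P.
(* An [a]-edge at [t e] starts the chain to be swapped; if there is none, [c] already serves. *)
have [f0 /and3P[f0F /eqP f0t /eqP cf0]|none] :=
    pickP [pred f | [&& f \in F', t f == t e & c f == a]]; last first.
  exists c; split=> // f fF ft; apply/negP=> cf.
  by have := none f; rewrite /= fF ft cf eqxx.
have ab : a != b by rewrite -cf0 b_miss.
have f0_end (f : E) : f \in F' -> t f = t f0 -> c f != b by rewrite f0t; apply: b_miss.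
exists (kempe_swap F' c a b f0); split.
- exact: kempe_swap_proper.
- exact: kempe_swap_lt.
- exact: kempe_swap_source.
- by rewrite -f0t; apply: kempe_swap_target.
Qed.

End Konig.

(** * Lower and upper bounds for incidence colourings *)

Section Incidences.
Variable G : sgraph.
Implicit Types (v w x y : G) (e f : {set G}) (A : {set G}).

Lemma edgesP e : reflect (exists x y, adj x y /\ e = [set x; y]) (e \in edges G).
Proof.
rewrite inE; apply: (iffP existsP) => [[x /existsP[y /andP[xy /eqP->]]]|].
  by exists x, y.
by case=> x [y [xy ->]]; exists x; apply/existsP; exists y; rewrite xy eqxx.
Qed.

Lemma adj_neq x y : adj x y -> x != y.
Proof. by apply: contraTneq => ->; rewrite adj_irrefl. Qed.

Lemma set2_inj_adj w : {in [set x | adj w x] &, injective (fun x => [set w; x])}.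
Proof.
move=> x y; rewrite !inE => wx _ /setP/(_ x); rewrite !inE eqxx orbT.
by rewrite eq_sym (negbTE (adj_neq wx)) => /esym/eqP.
Qed.

(** Each neighbour [x] of [w] gives two incidences on the edge [[set w; x]], one based at [w] (in
    [P]) and one at [x] (in [Q]). *)
Lemma card_incidences_at w : 2 * deg w <= #|incidences_at w|.
Proof.
rewrite -(card_imset _ val_inj) mul2n -addnn.
pose N := [set x | adj w x].
pose P := [set (w, [set w; x]) | x in N]; pose Q := [set (x, [set w; x]) | x in N].
have cP : #|P| = deg w.
  by apply: card_in_imset => x y xN yN [] /(set2_inj_adj xN yN).
have cQ : #|Q| = deg w by apply: card_in_imset => x y _ _ [].
have PQ : P :&: Q = set0.
  apply/setP=> p; rewrite in_setI in_set0; apply/negP=> /andP[/imsetP[x _ ->]].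
  by case/imsetP=> y; rewrite inE => wy [wy' _]; rewrite -wy' adj_irrefl in wy.
rewrite -{1}cP -cQ -cardsUI PQ cards0 addn0; apply/subset_leq_card/subsetP=> p.
have val_at v x : adj w x -> v \in [set w; x] ->
    (v, [set w; x]) \in [set val i | i in incidences_at w].
  move=> wx vwx; have pP : ([set w; x] \in edges G) && (v \in [set w; x]).
    by rewrite vwx andbT; apply/edgesP; exists w, x.
  apply/imsetP; exists (exist _ (v, [set w; x]) pP) => //.
  by rewrite inE /inc_edge /= !inE eqxx.
by case/setUP=> /imsetP[x]; rewrite inE => wx ->; apply: val_at;
  rewrite ?inE ?eqxx ?orbT.
Qed.

Lemma cf_colorable_lower k : cf_colorable G k -> 2 * max_degree G <= k.
Proof.
(* Dividing by 2 isolates the maximum, so that the bound can be checked degree by degree. *)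
case/existsP=> c /forallP cP; rewrite mulnC -leq_divRL //.
apply/bigmax_leqP=> w _; rewrite leq_divRL // mulnC.
apply: leq_trans (card_incidences_at w) _.
rewrite -[k in _ <= k]card_ord -(@card_in_imset _ _ c) ?max_card // => i j iw jw cij.
apply/eqP; apply: contraT => ij; have /forallP/(_ j)/implyP := cP i.
by rewrite cij eqxx; apply; rewrite /conflict ij; apply/existsP; exists w; rewrite iw.
Qed.

Lemma bipartite_edge A e :
  (forall x y, adj x y -> (x \in A) != (y \in A)) -> e \in edges G ->
  exists x y, [/\ adj x y, x \in A, y \notin A & e = [set x; y]].
Proof.
move=> hA /edgesP[x [y [xy ->]]]; have := hA x y xy.
case xA: (x \in A); case yA: (y \in A) => // _; first by exists x, y; rewrite yA.
by exists y, x; rewrite adj_sym xA setUC.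
Qed.

(* [e :&: A] plays the role of the endpoint of [e] in [A]. *)
Lemma card_edges_side A (X : {set G}) :
  (forall x y, adj x y -> (x \in A) != (y \in A)) ->
  #|[set e in edges G | e :&: A == X]| <= max_degree G.
Proof.
(* Any one edge of a nonempty class reveals the common endpoint [x] in [A]; the class then embeds
   into the neighbours of [x]. *)
move=> hA; have [->|/set0Pn[e]] := eqVneq [set e in edges G | e :&: A == X] set0.
  by rewrite cards0.
rewrite inE => /andP[/(bipartite_edge hA)[x [y [_ xA yA ->]]] /eqP <-].
apply: leq_trans (leq_bigmax x); apply: leq_trans (leq_imset_card (fun z => [set x; z]) _).
apply/subset_leq_card/subsetP=> f; rewrite inE.
case/andP=> /(bipartite_edge hA)[x' [y' [xy' xA' yA' ->]]] /eqP/setP/(_ x').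
rewrite !inE eqxx xA' !andbT /= => /esym/orP[]/eqP x'E; last by rewrite -x'E xA' in yA.
by apply/imsetP; exists y'; rewrite ?inE -x'E.
Qed.

Lemma cf_colorable_upper : bipartite G -> cf_colorable G (2 * max_degree G).
Proof.
case=> A hA; set D := max_degree G.
(* The complement is a bipartition too, so the degree bound holds on both sides. *)
have hAC x y : adj x y -> (x \in ~: A) != (y \in ~: A).
  by rewrite !inE => /hA; do 2 case: (_ \in A).
have [c cP cD] := konig_edge_colouring
  (fun X => card_edges_side X hA) (fun X => card_edges_side X hAC).
have iE (i : incidence G) : inc_edge i \in edges G by case/andP: (valP i).
have iV (i : incidence G) : (val i).1 \in inc_edge i by case/andP: (valP i).
pose g (i : incidence G) := c (inc_edge i) + D * ((val i).1 \in A).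
have gD i : g i < 2 * D.
  by have := cD _ (iE i); rewrite /g; case: (_ \in A); lia.
apply/existsP; exists [ffun i => Ordinal (gD i)].
apply/forallP=> i; apply/forallP=> j; apply/implyP=> /andP[ij /existsP[w]].
rewrite !inE !ffunE => /andP[wi wj]; apply: contra ij => /eqP [gij].
have ci := cD _ (iE i); have cj := cD _ (iE j).
(* Since [c] is below [D] on edges, [g] determines both the edge colour and the side. *)
have [cij sij] : c (inc_edge i) = c (inc_edge j)
    /\ ((val i).1 \in A) = ((val j).1 \in A).
  by move: gij; rewrite /g; do 2 case: (_ \in A); lia.
have [xi [yi [_ xiA yiA ei]]] := bipartite_edge hA (iE i).
have [xj [yj [_ xjA yjA ej]]] := bipartite_edge hA (iE j).
have side x y (B : {set G}) : x \in B -> y \notin B -> [set x; y] :&: B = [set x].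
  move=> xB yB; apply/setP=> z; rewrite !inE.
  case: eqVneq => [->|_] /=; first by rewrite xB.
  by case: eqVneq => // ->; rewrite (negbTE yB).
have sideC x y : x \in A -> y \notin A -> [set x; y] :&: ~: A = [set y].
  by move=> xA yA; rewrite setUC side // !inE ?xA.
(* The shared vertex [w] is the endpoint of both edges on the same side, so properness of [c]
   applies. *)
have eij : inc_edge i = inc_edge j.
  apply: cP => //.
  move: wi wj; rewrite ei ej !(side _ _ A) // !sideC // !inE.
  move=> /orP[]/eqP-> /orP[]/eqP h; rewrite ?h ?eqxx ?orbT //.
    by rewrite -h xiA in yjA.
  by rewrite h xjA in yiA.
apply/eqP/val_inj; rewrite [val i]surjective_pairing [val j]surjective_pairing.
(* An edge has just one endpoint on each side, so equal sides force equal vertices. *)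
congr (_, _) => //; have := iV i; have := iV j; rewrite -eij ei !inE => hj hi.
by move: sij; case/orP: hi => /eqP->; case/orP: hj => /eqP->;
  rewrite ?xiA ?(negbTE yiA).
Qed.

End Incidences.

Theorem theorem2p4 (G : sgraph) (hG : bipartite G) :
  cf_incidence_chromatic G = 2 * max_degree G.
Proof.
rewrite /cf_incidence_chromatic; case: ex_minnP => k kP kmin.
apply/eqP; rewrite eqn_leq cf_colorable_lower // andbT.
exact/kmin/cf_colorable_upper.
Qed.
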